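(* For every integer $k \geq 0$, the neighborhood complex $\mathcal{N}(S_{2,k})$ of the graph $S_{2,k}$ is homotopy equivalent to the $k$-sphere $S^k$.
   Context: Let $[n]=\{1,\dots,n\}$. The Kneser graph $KG_{2,k}$ has as vertices the 2-element subsets $\{i,j\}$ ($i\neq j$) of $[k+4]$, and two vertices $v_1,v_2$ are adjacent if and only if $v_1\cap v_2=\emptyset$. A vertex $\{i,j\}$ is stable if $j\neq i\pm 1$ modulo $k+4$; otherwise it is unstable. The graph $S_{2,k}$ is the subgraph of $KG_{2,k}$ with the same vertex set $V(S_{2,k})=V(KG_{2,k})$ and with edge set consisting of those edges $(u,v)$ of $KG_{2,k}$ such that at least one of $u,v$ is stable. The neighborhood complex $\mathcal{N}(G)$ of a graph $G$ is the abstract simplicial complex whose vertices are the non-isolated vertices of $G$ and whose simplices are the subsets of $V(G)$ having a common neighbor in $G$. Homotopy equivalence refers to its geometric realization. *)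

(* Defs.v *)
From HB Require Import structures.
From mathcomp Require Import all_boot all_order all_algebra.
From mathcomp Require Import all_classical all_reals all_analysis.

Set Implicit Arguments.
Unset Strict Implicit.
Unset Printing Implicit Defensive.

Import Order.TTheory GRing.Theory Num.Theory.
Import numFieldNormedType.Exports.

Local Open Scope classical_set_scope.
Local Open Scope ring_scope.

(* Only the values of H on X * [0, 1] matter. *)
Definition homotopic (R : realType) (X Y : topologicalType) (f g : X -> Y) :=
  exists H : X * R -> Y,
    [/\ {within [set: X] `*` `[0, 1], continuous H},
        forall x, H (x, 0) = f x
      & forall x, H (x, 1) = g x].

Definition homotopy_equivalent (R : realType) (X Y : topologicalType) :=
  exists (f : X -> Y) (g : Y -> X),
    [/\ continuous f, continuous g,
        homotopic R (g \o f) idfun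
      & homotopic R (f \o g) idfun].

Definition sphere (R : realType) (k : nat) : set 'rV[R]_k.+1 :=
  [set x | \sum_(i < k.+1) x ord0 i ^+ 2 = 1].
Arguments sphere : clear implicits.

(* The empty set is allowed as a simplex; it contributes no point to the
   geometric realization. *)
Record simplicial_complex (V : finType) := SimplicialComplex {
  vertices : {set V};
  simplices : {set {set V}};
  simplex_sub : forall s, s \in simplices -> s \subset vertices;
  vertex_simplex : forall v, v \in vertices -> [set v]%SET \in simplices;
  face_simplex : forall s t : {set V},
    s \in simplices -> t \subset s -> t \in simplices }.

(* Barycentric coordinates. As V is finite, the topology induced by R^V is the
   usual one. *)
Definition realization (R : realType) (V : finType) (K : simplicial_complex V) :
    set {ptws V -> R} :=
  [set x | [/\ forall v, 0 <= x v,
               \sum_v x v = 1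
             & [set v | x v != 0]%SET \in simplices K]].
Arguments realization R {V} K _.

Record sgraph (V : finType) := SGraph {
  adj :> rel V;
  adj_sym : symmetric adj;
  adj_irr : irreflexive adj }.

Section NeighborhoodComplex.
Variables (V : finType) (G : sgraph V).

Definition non_isolated : {set V} := [set v | [exists w, G v w]]%SET.

Definition common_nbr_sets : {set {set V}} :=
  [set s : {set V} | [exists w, forall v in s, G v w]]%SET.

Lemma common_nbr_sets_sub s : s \in common_nbr_sets -> s \subset non_isolated.
Proof.
rewrite inE => /existsP[w /forall_inP sw]; apply/fintype.subsetP => v vs.
by rewrite inE; apply/existsP; exists w; exact: sw.
Qed.

Lemma common_nbr_sets1 v :
  v \in non_isolated -> [set v]%SET \in common_nbr_sets.
Proof.
rewrite !inE => /existsP[w vw]; apply/existsP; exists w.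
by apply/forall_inP => u; rewrite inE => /eqP ->.
Qed.

Lemma common_nbr_sets_face (s t : {set V}) :
  s \in common_nbr_sets -> t \subset s -> t \in common_nbr_sets.
Proof.
rewrite !inE => /existsP[w /forall_inP sw] /fintype.subsetP ts; apply/existsP.
by exists w; apply/forall_inP => v /ts; exact: sw.
Qed.

Definition neighborhood_complex : simplicial_complex V :=
  SimplicialComplex common_nbr_sets_sub common_nbr_sets1 common_nbr_sets_face.

End NeighborhoodComplex.

Section KneserGraphs.
Variable k : nat.

(* 'I_k.+4 = {0, ..., k+3} stands for {1, ..., k+4}, with i standing for i+1;
   the shift does not affect congruences modulo k+4. *)
Definition pair2 := {A : {set 'I_k.+4} | #|A| == 2%N}.

Definition kneser_adj : rel pair2 := fun u v => val u :&: val v == finset.set0.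

Lemma kneser_adj_sym : symmetric kneser_adj.
Proof. by move=> u v; rewrite /kneser_adj finset.setIC. Qed.

Lemma kneser_adj_irr : irreflexive kneser_adj.
Proof.
move=> u; apply/negP; rewrite /kneser_adj finset.setIid => /eqP u0.
by have := valP u; rewrite u0 cards0.
Qed.

Definition kneser : sgraph pair2 := SGraph kneser_adj_sym kneser_adj_irr.

(* j <> i - 1 is written as j + 1 <> i. *)
Definition stable (u : pair2) : bool :=
  [forall i in val u, forall j in val u, (i != j) ==>
    (j != i + 1 %[mod k + 4])%N && (j + 1 != i %[mod k + 4])%N].

Definition S2_adj : rel pair2 :=
  fun u v => kneser u v && (stable u || stable v).

Lemma S2_adj_sym : symmetric S2_adj.
Proof. by move=> u v; rewrite /S2_adj adj_sym orbC. Qed.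

Lemma S2_adj_irr : irreflexive S2_adj.
Proof. by move=> u; rewrite /S2_adj adj_irr. Qed.

Definition S2 : sgraph pair2 := SGraph S2_adj_sym S2_adj_irr.

End KneserGraphs.

(* Main.v *)
(** Put the k+4 points at 0, ..., k+3 on the real line.  A vector x of R^(k+1)
    is a polynomial of degree at most k, and [altern x c] is its value at c
    multiplied by (-1)^c.  The orthogonality of polynomials of degree at most k
    to the weights (-1)^c binom(k+3, c) q(c), q quadratic, shows that for x <> 0
    these values are positive on some stable pair, hence also negative on some
    stable pair.  So x in S^k defines the set of stable pairs on which it is
    positive, and these have a common neighbour.  Conversely each stable pair v
    has a polynomial negative at all points outside v; extending
    barycentrically gives a map from the stable part of the neighborhood complex
    to R^(k+1) minus the origin.  After normalization the two maps are homotopy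
    inverse to each other by straight-line homotopies, because negative values at
    a given point are never destroyed.

    The unstable pairs b = {i, i+1} are removed from the complex one at a time.
    If a stable pair {c, d} is disjoint from a simplex containing b, then b may be
    exchanged for the stable pairs {i, x} with x strictly between c and d on the
    arc avoiding b; taking for c and d the outermost points that carry little
    mass keeps this consistent when the simplex varies. *)

Require Import Defs.
From mathcomp Require Import all_boot all_order all_algebra.
From mathcomp Require Import all_classical all_reals all_analysis.
From mathcomp Require Import zify ring lra.

Import numFieldNormedType.Exports.
Import Order.TTheory GRing.Theory Num.Theory.

Set Implicit Arguments.
Unset Strict Implicit.
Unset Printing Implicit Defensive.

Local Open Scope classical_set_scope.
Local Open Scope ring_scope.

(** * Continuity and homotopy *)

Lemma continuous_fst (X Y : topologicalType) : continuous (@fst X Y).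
Proof. by move=> p; exact: cvg_fst. Qed.

Lemma continuous_snd (X Y : topologicalType) : continuous (@snd X Y).
Proof. by move=> p; exact: cvg_snd. Qed.

Lemma continuous_pair (X Y Z : topologicalType) (f : X -> Y) (g : X -> Z) :
  continuous f -> continuous g -> continuous (fun x => (f x, g x)).
Proof. by move=> cf cg x; exact: cvg_pair (cf x) (cg x). Qed.

Section Continuity.
Variables (R : realType) (X : topologicalType).
Implicit Types f g : X -> R.

Lemma continuousD_fun f g :
  continuous f -> continuous g -> continuous (fun x => f x + g x).
Proof. by move=> cf cg x; apply: cvgD; [exact: cf|exact: cg]. Qed.

Lemma continuousB_fun f g :
  continuous f -> continuous g -> continuous (fun x => f x - g x).
Proof. by move=> cf cg x; apply: cvgB; [exact: cf|exact: cg]. Qed.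

Lemma continuousM_fun f g :
  continuous f -> continuous g -> continuous (fun x => f x * g x).
Proof. by move=> cf cg x; apply: cvgM; [exact: cf|exact: cg]. Qed.

Lemma continuous_max_fun f g :
  continuous f -> continuous g -> continuous (fun x => Num.max (f x) (g x)).
Proof. by move=> cf cg x; apply: continuous_max; [exact: cf|exact: cg]. Qed.

Lemma continuous_min_fun f g :
  continuous f -> continuous g -> continuous (fun x => Num.min (f x) (g x)).
Proof. by move=> cf cg x; apply: continuous_min; [exact: cf|exact: cg]. Qed.

Lemma continuous_sum_fun (I : Type) (r : seq I) (P : pred I) (F : I -> X -> R) :
  (forall i, P i -> continuous (F i)) ->
  continuous (fun x => \sum_(i <- r | P i) F i x).
Proof.
move=> cF; apply: continuous_big => //.
by move=> x; apply: cvgD; [exact: cvg_fst|exact: cvg_snd].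
Qed.

Lemma continuous_prod_fun (I : Type) (r : seq I) (P : pred I) (F : I -> X -> R) :
  (forall i, P i -> continuous (F i)) ->
  continuous (fun x => \prod_(i <- r | P i) F i x).
Proof.
move=> cF; apply: continuous_big => //.
by move=> x; apply: cvgM; [exact: cvg_fst|exact: cvg_snd].
Qed.

End Continuity.

Section Homotopy.
Variable R : realType.

Lemma clamp_itv (t : R) : Num.max 0 (Num.min t 1) \in `[0, 1].
Proof. by rewrite in_itv /= le_max lexx ge_max ler01 ge_min lexx orbT. Qed.

Lemma clamp_id (t : R) : t \in `[0, 1] -> Num.max 0 (Num.min t 1) = t.
Proof. by rewrite in_itv /= => /andP[t0 t1]; rewrite min_l // max_r. Qed.

Lemma continuous_clamp (X : topologicalType) (f : X -> R) :
  continuous f -> continuous (fun x => Num.max 0 (Num.min (f x) 1)).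
Proof.
move=> cf; apply: continuous_max_fun; first exact: cst_continuous.
by apply: continuous_min_fun => //; exact: cst_continuous.
Qed.

(** Precomposing with the clamp of the time to [0, 1] turns continuity on the strip into continuity
    on all of [X * R], so that homotopies can be handled as globally continuous maps. *)
Lemma homotopicP (X Y : topologicalType) (f g : X -> Y) :
  homotopic R f g <->
  exists H : X * R -> Y,
    [/\ continuous H, forall x, H (x, 0) = f x & forall x, H (x, 1) = g x].
Proof.
split=> -[H [cH H0 H1]]; last first.
  by exists H; split=> //; exact: continuous_subspaceT.
exists (fun p => H (p.1, Num.max 0 (Num.min p.2 1))).
split; last 2 first.
- by move=> x /=; rewrite clamp_id // in_itv /= lexx ler01.
- by move=> x /=; rewrite clamp_id // in_itv /= lexx ler01.
move=> p; set A := [set: X] `*` `[0, 1]%classic in cH *.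
pose c (p : X * R) := (p.1, Num.max 0 (Num.min p.2 1)).
have Ac q : A (c q) by split=> //=; exact: clamp_itv.
have cc : continuous c.
  apply: continuous_pair; first exact: continuous_fst.
  by apply: continuous_clamp; exact: continuous_snd.
have {}cH : H @ within A (nbhs (c p)) --> H (c p).
  by move: cH; rewrite subspace_continuousP; exact.
move=> U /cH; rewrite /= nbhs_simpl /within /= => cU.
have := cc p _ cU; rewrite nbhs_simpl /= => {}cU.
by apply: filterS cU => q /=; exact.
Qed.

Lemma homotopic_comp (X Y Z W : topologicalType) (f g : X -> Y) (a : W -> X)
    (b : Y -> Z) :
  continuous a -> continuous b -> homotopic R f g ->
  homotopic R (b \o f \o a) (b \o g \o a).
Proof.
move=> ca cb /homotopicP[H [cH H0 H1]]; apply/homotopicP.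
exists (fun p => b (H (a p.1, p.2))); split; last 2 first.
- by move=> x /=; rewrite H0.
- by move=> x /=; rewrite H1.
move=> p; apply: (@continuous_comp _ _ _ (fun p => H (a p.1, p.2)) b); last exact: cb.
apply: (@continuous_comp _ _ _ (fun p => (a p.1, p.2)) H); last exact: cH.
apply: continuous_pair; last exact: continuous_snd.
by move=> q; apply: (@continuous_comp _ _ _ fst a); [exact: continuous_fst|exact: ca].
Qed.

Lemma homotopic_trans (X Y : topologicalType) (f g h : X -> Y) :
  homotopic R f g -> homotopic R g h -> homotopic R f h.
Proof.
move=> /homotopicP[H [cH H0 H1]] /homotopicP[K [cK K0 K1]]; apply/homotopicP.
pose L (p : X * R) := if p.2 <= 2^-1 then H (p.1, 2 * p.2) else K (p.1, 2 * p.2 - 1).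
exists L; split; last 2 first.
- by move=> x; rewrite /L /= ifT ?mulr0 ?H0 // invr_ge0.
- move=> x; rewrite /L /= ifF; first by rewrite -K1; congr (K (_, _)); lra.
  by apply/negbTE; rewrite -ltNge; lra.
have mul2 : continuous (fun p : X * R => 2 * p.2).
  by apply: continuousM_fun; [exact: cst_continuous|exact: continuous_snd].
have cHL : continuous (fun p : X * R => H (p.1, 2 * p.2)).
  move=> p; apply: (@continuous_comp _ _ _ (fun p : X * R => (p.1, 2 * p.2)) H).
    by apply: continuous_pair => //; exact: continuous_fst.
  exact: cH.
have cKL : continuous (fun p : X * R => K (p.1, 2 * p.2 - 1)).
  move=> p; apply: (@continuous_comp _ _ _ (fun p : X * R => (p.1, 2 * p.2 - 1)) K).
    apply: continuous_pair; first exact: continuous_fst.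
    by apply: continuousB_fun => //; exact: cst_continuous.
  exact: cK.
pose A := [set p : X * R | p.2 <= 2^-1]; pose B := [set p : X * R | 2^-1 <= p.2].
have cA : closed A.
  by apply: (@closed_comp _ _ (snd : X * R -> R) [set x | x <= 2^-1]) => // p _; exact: continuous_snd.
have cB : closed B.
  by apply: (@closed_comp _ _ (snd : X * R -> R) [set x | 2^-1 <= x]) => // p _; exact: continuous_snd.
have AB : A `|` B = setT.
  by apply/seteqP; split => // p _; rewrite /A /B /=; case: (leP p.2 2^-1) => [|/ltW]; [left|right].
have : {within A `|` B, continuous L}.
  apply: withinU_continuous => //.
    apply: (@subspace_eq_continuous _ _ _ (fun p : X * R => H (p.1, 2 * p.2))).
      by move=> p /set_mem pA; rewrite /from_subspace /L ifT.
    exact: continuous_subspaceT.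
  apply: (@subspace_eq_continuous _ _ _ (fun p : X * R => K (p.1, 2 * p.2 - 1))).
    move=> p /set_mem pB; rewrite /from_subspace /L; case: ifP => // pA.
    (* The closed halves meet only at time 1/2, where [H] at time 1 and [K] at time 0 are both
       [g]. *)
    have -> : p.2 = 2^-1 by apply/eqP; rewrite eq_le pA; exact: pB.
    by rewrite divff // subrr K0 H1.
  exact: continuous_subspaceT.
rewrite AB => cL; exact/continuous_subspace_setT.
Qed.

Lemma homotopy_equivalent_trans (X Y Z : topologicalType) :
  homotopy_equivalent R X Y -> homotopy_equivalent R Y Z ->
  homotopy_equivalent R X Z.
Proof.
move=> [f [g [cf cg gf fg]]] [f' [g' [cf' cg' gf' fg']]].
exists (f' \o f), (g \o g'); split.
- by move=> x; apply: continuous_comp; [exact: cf|exact: cf'].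
- by move=> x; apply: continuous_comp; [exact: cg'|exact: cg].
- by apply: homotopic_trans gf; exact: (homotopic_comp cf cg gf').
- by apply: homotopic_trans fg'; exact: (homotopic_comp cg' cf' fg).
Qed.

End Homotopy.

(** * Maps into polyhedra and spheres *)

Lemma set_val_continuous (Y : topologicalType) (A : set Y) :
  continuous (fun x : set_type A => val x).
Proof. exact: initial_continuous. Qed.

Lemma set_typeP (Y : Type) (A : set Y) (x : set_type A) : A (val x).
Proof. exact: set_mem (valP x). Qed.

Section PositiveSums.
Variable R : realType.

Lemma sum_gt0P (I : finType) (P : pred I) (F : I -> R) :
  (forall x, 0 <= F x) -> 0 < \sum_(x | P x) F x -> exists2 x, P x & 0 < F x.
Proof.
move=> F0 sF; have /psumr_neq0P[|x /andP[Px Fx]] : \sum_(x | P x) F x <> 0.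
- by apply/eqP; rewrite gt_eqF.
- by move=> x _; exact: F0.
- by exists x.
Qed.

Lemma sum_gt0 (I : finType) (P : pred I) (F : I -> R) (x : I) :
  (forall y, 0 <= F y) -> P x -> 0 < F x -> 0 < \sum_(y | P y) F y.
Proof.
move=> F0 Px Fx; rewrite (bigD1 x) //= ltr_wpDr //.
by apply: sumr_ge0 => y _; exact: F0.
Qed.

End PositiveSums.

Section Normalization.
Variables (R : realType) (X : topologicalType).

Lemma continuous_set_type (Y : topologicalType) (A : set Y) (f : X -> Y)
    (fA : forall x, A (f x)) :
  continuous f -> continuous (fun x => exist _ (f x) (mem_set (fA x)) : set_type A).
Proof. by move=> cf; apply: continuous_comp_initial. Qed.

Lemma continuous_ptws (V : choiceType) (f : X -> {ptws V -> R}) :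
  (forall v, continuous (fun x => f x v)) -> continuous f.
Proof.
move=> cf x; apply/cvg_sup => v.
exact: (@continuous_comp_initial (V -> R) X R (fun w => w v) f (cf v)).
Qed.

Variables (V : finType).

(** A geometric realization for a bare predicate [D], so that subcomplexes can be cut out by boolean
    conditions without rebuilding a [simplicial_complex]. *)
Definition polyhedron (D : {pred {set V}}) : set {ptws V -> R} :=
  [set x | [/\ forall v, 0 <= x v, \sum_v x v = 1 & [set v | x v != 0]%SET \in D]].

(** Points of [polyhedron D] before normalization. Positive mass is asked separately because [D] may
    contain the empty set. *)
Definition weights_in (D : {pred {set V}}) (w : V -> R) :=
  [/\ forall v, 0 <= w v, exists v, 0 < w v & [set v | w v != 0]%SET \in D].

Lemma weights_sum_gt0 D w : weights_in D w -> 0 < \sum_v w v.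
Proof.
move=> [w0 [v wv] _]; rewrite (bigD1 v) //=.
by rewrite ltr_wpDr // sumr_ge0.
Qed.

Lemma normalize_weights D w : weights_in D w ->
  polyhedron D (fun v => w v / \sum_u w u).
Proof.
move=> /[dup] /weights_sum_gt0 s0 [w0 _ wD]; split.
- by move=> v; rewrite divr_ge0 // ltW.
- by rewrite -mulr_suml divff // gt_eqF.
- congr (_ \in D): wD; apply/setP => v; rewrite !inE mulf_eq0 invr_eq0.
  by rewrite (gt_eqF s0) orbF.
Qed.

Lemma normalize_weights_continuous D (F : X -> V -> R) :
  (forall v, continuous (fun x => F x v)) -> (forall x, weights_in D (F x)) ->
  exists h : X -> set_type (polyhedron D),
    continuous h /\ forall x v, val (h x) v = F x v / \sum_u F x u.
Proof.
move=> cF FD.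
pose G x : {ptws V -> R} := fun v => F x v / \sum_u F x u.
have GD x : polyhedron D (G x) by exact: normalize_weights.
exists (fun x => exist _ (G x) (mem_set (GD x))); split=> //.
apply: continuous_set_type; apply: continuous_ptws => v x.
apply: cvgM; first exact: cF.
apply: cvgV; first by rewrite gt_eqF // (weights_sum_gt0 (FD x)).
by apply: continuous_sum_fun => u _; exact: cF.
Qed.

End Normalization.

Section PolyhedronHomotopy.
Variables (R : realType) (X : topologicalType) (V : finType).
Variable D : {pred {set V}}.

(** Dividing by the positive total mass preserves supports, so a homotopy may be written with
    unnormalized weights. Clamping the time confines the condition on [F] to [0, 1]. *)
Lemma homotopic_polyhedron (f g : X -> set_type (@polyhedron R V D))
    (F : X * R -> V -> R) :
    (forall v, continuous (fun p => F p v)) ->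
    (forall x t, t \in `[0, 1] -> weights_in D (F (x, t))) ->
    (forall x v, val (f x) v = F (x, 0) v / \sum_u F (x, 0) u) ->
    (forall x v, val (g x) v = F (x, 1) v / \sum_u F (x, 1) u) ->
  homotopic R f g.
Proof.
move=> cF FD f0 g1.
pose c (p : X * R) := (p.1, Num.max 0 (Num.min p.2 1)).
have cc : continuous c.
  apply: continuous_pair; first exact: continuous_fst.
  by apply: continuous_clamp; exact: continuous_snd.
have [||H [cH HF]] := @normalize_weights_continuous R (X * R)%type V D (F \o c).
- by move=> v p; apply: (@continuous_comp _ _ _ c (fun p => F p v)); [exact: cc|exact: cF].
- by move=> p; apply: FD; exact: clamp_itv.
apply/homotopicP; exists H; split=> // x; apply: val_inj; apply/funext => v.
- by rewrite HF f0 /= /c /= clamp_id // in_itv /= lexx ler01.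
- by rewrite HF g1 /= /c /= clamp_id // in_itv /= lexx ler01.
Qed.

End PolyhedronHomotopy.

Section SphereMaps.
Variables (R : realType) (k : nat).

Definition normE (x : 'rV[R]_k.+1) := Num.sqrt (\sum_(i < k.+1) x ord0 i ^+ 2).

Lemma sumsq_gt0 (x : 'rV[R]_k.+1) : x != 0 -> 0 < \sum_(i < k.+1) x ord0 i ^+ 2.
Proof.
move=> x0; rewrite lt0r sumr_ge0 ?andbT; last by move=> i _; exact: sqr_ge0.
apply: contra x0; rewrite psumr_eq0; last by move=> i _; exact: sqr_ge0.
move=> /allP x0; apply/eqP/rowP => i; rewrite mxE; apply/eqP.
by rewrite -sqrf_eq0; apply: x0; rewrite mem_index_enum.
Qed.

Lemma normE_gt0 (x : 'rV[R]_k.+1) : x != 0 -> 0 < normE x.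
Proof. by move=> x0; rewrite sqrtr_gt0 sumsq_gt0. Qed.

Lemma sphere_neq0 (x : 'rV[R]_k.+1) : sphere R k x -> x != 0.
Proof.
rewrite /sphere /= => x1; apply/eqP => x0; move: x1; rewrite x0 big1 => [/eqP|i _].
  by rewrite eq_sym oner_eq0.
by rewrite mxE expr0n.
Qed.

Lemma normalize_sphere (x : 'rV[R]_k.+1) : x != 0 -> sphere R k ((normE x)^-1 *: x).
Proof.
move=> x0; rewrite /sphere /=.
under eq_bigr do rewrite mxE exprMn.
rewrite -mulr_sumr exprVn /normE sqr_sqrtr; last exact/ltW/sumsq_gt0.
by rewrite mulVf // gt_eqF // sumsq_gt0.
Qed.

Lemma normalize_sphere_id (x : 'rV[R]_k.+1) : sphere R k x -> (normE x)^-1 *: x = x.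
Proof. by rewrite /sphere /normE /= => ->; rewrite sqrtr1 invr1 scale1r. Qed.

Lemma normalize_sphere_continuous (X : topologicalType) (F : X -> 'rV[R]_k.+1) :
  continuous F -> (forall x, F x != 0) ->
  exists h : X -> set_type (sphere R k),
    continuous h /\ forall x, val (h x) = (normE (F x))^-1 *: F x.
Proof.
move=> cF F0; exists (fun x => exist _ ((normE (F x))^-1 *: F x) (mem_set (normalize_sphere (F0 x)))).
split=> //; apply: continuous_set_type => x; apply: cvgZ; last exact: cF.
apply: cvgV; first by rewrite gt_eqF // normE_gt0.
apply: (@continuous_comp _ _ _ (fun x => \sum_i F x ord0 i ^+ 2) (@Num.sqrt R)).
  apply: continuous_sum_fun => i _.
  have ci : continuous (fun x => F x ord0 i).
    move=> y; apply: (@continuous_comp _ _ _ F (fun u => u ord0 i)); first exact: cF.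
    exact: coord_continuous.
  exact: continuousM_fun.
exact: sqrt_continuous.
Qed.

Lemma homotopic_sphere (X : topologicalType) (f g : X -> set_type (sphere R k))
    (F : X * R -> 'rV[R]_k.+1) :
    continuous F ->
    (forall x t, t \in `[0, 1] -> F (x, t) != 0) ->
    (forall x, val (f x) = (normE (F (x, 0)))^-1 *: F (x, 0)) ->
    (forall x, val (g x) = (normE (F (x, 1)))^-1 *: F (x, 1)) ->
  homotopic R f g.
Proof.
move=> cF F0 f0 g1.
pose c (p : X * R) := (p.1, Num.max 0 (Num.min p.2 1)).
have cc : continuous c.
  apply: continuous_pair; first exact: continuous_fst.
  by apply: continuous_clamp; exact: continuous_snd.
have [||H [cH HF]] := @normalize_sphere_continuous (X * R)%type (F \o c).
- by move=> p; apply: (@continuous_comp _ _ _ c F); [exact: cc|exact: cF].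
- by move=> p; apply: F0; exact: clamp_itv.
apply/homotopicP; exists H; split=> // x; apply: val_inj.
- by rewrite HF f0 /= /c /= clamp_id // in_itv /= lexx ler01.
- by rewrite HF g1 /= /c /= clamp_id // in_itv /= lexx ler01.
Qed.

End SphereMaps.

(** * Removing a vertex from a complex *)

Section VertexRemoval.
Variables (R : realType) (V : finType) (D : {pred {set V}}) (b : V) (delta : R).
Variable zeta : (V -> R) -> V -> R.

Definition without : {pred {set V}} := [pred s | (s \in D) && (b \notin s)].

(* The masses are first decreased by [a * delta], and then a proportion [l] of
   what remains at [b] is moved along [zeta].  The two stages are necessary: the
   support of [zeta] is compatible only with the vertices of mass at least
   [delta]. *)
Definition spread (y : V -> R) (a l : R) (v : V) : R :=
  let tau u := Num.max 0 (y u - a * delta) in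
  if v == b then (1 - l) * tau b else tau v + l * (tau b * zeta y v).

Hypothesis D_face : forall s t : {set V}, s \in D -> t \subset s -> t \in D.
Hypothesis delta_gt0 : 0 < delta.
Hypothesis delta_lt : delta *+ #|V| < 1.
Hypothesis zeta_cont : forall v, continuous (fun y : {ptws V -> R} => zeta y v).
Hypothesis zeta_ge0 : forall y v, 0 <= zeta y v.
Hypothesis zetaD : forall y, polyhedron D y -> delta < y b ->
  [set v | (delta < y v) || (0 < zeta y v)]%SET \in D.
Hypothesis zeta_pos : forall y, polyhedron D y -> delta < y b ->
  exists2 v, v != b & 0 < zeta y v.

Let spread0 y v : (forall u, 0 <= y u) -> spread y 0 0 v = y v.
Proof.
by move=> y0; rewrite /spread !(mul0r, subr0, addr0, mul1r) !max_r //; case: eqP => [->|].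
Qed.

(** Otherwise the total mass would be at most [delta *+ #|V|], hence less than 1. *)
Lemma exists_gt_delta (y : V -> R) : \sum_v y v = 1 -> exists v, delta < y v.
Proof.
move=> y1; apply: contrapT => /forallNP y_le.
have : \sum_v y v <= \sum_(v : V) delta.
  by apply: ler_sum => v _; rewrite leNgt; apply/negP; exact: y_le.
by rewrite y1 sumr_const -[#|_|]/#|V| leNgt delta_lt.
Qed.

(** A vertex of mass above [delta] survives the decrease; if it is [b] and all of [b] is moved,
    [zeta_pos] supplies a vertex that receives mass. If [tau b] or [l] is 0, the support only
    shrinks. Otherwise [a = 1], so [b] has mass above [delta] and the new support lies in the
    simplex of [zetaD]. *)
Lemma spread_in y a l : polyhedron D y -> 0 <= a <= 1 -> 0 <= l <= 1 ->
  l = 0 \/ a = 1 -> weights_in D (spread y a l).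
Proof.
move=> yD /andP[a0 a1] /andP[l0 l1] la; have [y0 y1 Dy] := yD.
have tau0 u : 0 <= Num.max 0 (y u - a * delta) by rewrite le_max lexx.
have tauP u : 0 < Num.max 0 (y u - a * delta) -> a * delta < y u.
  by rewrite lt_max ltxx /= subr_gt0.
have tau_gt u : delta < y u -> 0 < Num.max 0 (y u - a * delta).
  move=> yu; rewrite lt_max subr_gt0; apply/orP; right; apply: le_lt_trans yu.
  by rewrite ler_piMl // ltW.
have tau_y u : 0 < Num.max 0 (y u - a * delta) -> y u != 0.
  by move/tauP => h; rewrite gt_eqF //; apply: le_lt_trans h; rewrite mulr_ge0 // ltW.
have sp0 v : 0 <= spread y a l v.
  rewrite /spread; case: ifP => _; first by rewrite mulr_ge0 // subr_ge0.
  by rewrite addr_ge0 // !mulr_ge0.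
split=> //.
- have [v yv] := exists_gt_delta y1.
  have [vb|vb] := eqVneq v b; last first.
    exists v; rewrite /spread (negbTE vb).
    by apply: ltr_wpDr; [rewrite !mulr_ge0|exact: tau_gt].
  rewrite vb in yv.
  have [l_lt1|l_ge1] := ltP l 1.
    by exists b; rewrite /spread eqxx mulr_gt0 ?subr_gt0 // tau_gt.
  have [u ub zu] := zeta_pos yD yv.
  exists u; rewrite /spread (negbTE ub); apply: ltr_wpDl => //.
  by rewrite !mulr_gt0 ?tau_gt // (lt_le_trans ltr01 l_ge1).
- have [tb|tb] := leP (Num.max 0 (y b - a * delta)) 0.
    apply: (D_face Dy); apply/fintype.subsetP => v; rewrite !inE /spread.
    have {}tb : Num.max 0 (y b - a * delta) = 0 by apply/eqP; rewrite eq_le tb tau0.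
    case: (v == b); rewrite tb ?mul0r !mulr0 ?addr0 ?eqxx // => tv.
    by apply: tau_y; rewrite lt0r tv tau0.
  case: la => [l00|a11].
    apply: (D_face Dy); apply/fintype.subsetP => v; rewrite !inE /spread l00.
    rewrite subr0 mul1r mul0r addr0; case: (v =P b) => [->|_] tv.
      by apply: tau_y; rewrite lt0r tv tau0.
    by apply: tau_y; rewrite lt0r tv tau0.
  have yb : delta < y b by move/tauP: tb; rewrite a11 mul1r.
  apply: (D_face (zetaD yD yb)); apply/fintype.subsetP => v; rewrite !inE /spread.
  case: (v =P b) => [-> _|_]; first by rewrite yb.
  apply: contraTT; rewrite negb_or -!leNgt => /andP[yv zv].
  have -> : zeta y v = 0 by apply/eqP; rewrite eq_le zv zeta_ge0.
  rewrite a11 mul1r max_l ?subr_le0 // !mulr0 addr0.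
  by rewrite eqxx.
Qed.

Lemma spread_without y : polyhedron D y -> weights_in without (spread y 1 1).
Proof.
move=> yD; have h01 : 0 <= (1 : R) <= 1 by rewrite ler01 lexx.
have [? ? sD] := @spread_in y 1 1 yD h01 h01 (or_intror erefl).
by split=> //; rewrite inE /= sD inE /spread eqxx subrr mul0r eqxx.
Qed.

Lemma polyhedron_without (y : {ptws V -> R}) : polyhedron without y -> polyhedron D y /\ y b = 0.
Proof.
move=> [y0 y1]; rewrite inE /= inE negbK => /andP[yD /eqP yb].
by split.
Qed.

Lemma spread_in_without (y : {ptws V -> R}) a l : polyhedron without y -> 0 <= a <= 1 -> 0 <= l <= 1 ->
  l = 0 \/ a = 1 -> weights_in without (spread y a l).
Proof.
move=> /polyhedron_without[yD yb] a01 l01 la; have [? ? sD] := @spread_in y a l yD a01 l01 la.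
split=> //; rewrite inE /= sD inE /spread eqxx yb sub0r max_l ?mulr0 ?eqxx //.
by case/andP: a01 => a0 _; rewrite oppr_le0 mulr_ge0 // ltW.
Qed.

Lemma spread_continuous (X : topologicalType) (f : X -> {ptws V -> R}) (a l : X -> R) v :
  continuous f -> continuous a -> continuous l ->
  continuous (fun x => spread (f x) (a x) (l x) v).
Proof.
move=> cf ca cl.
have cfv u : continuous (fun x => f x u).
  move=> x; apply: (@continuous_comp _ _ _ f (fun y => y u)); first exact: cf.
  exact: (@proj_continuous V (fun=> R) u).
have ctau u : continuous (fun x => Num.max 0 (f x u - a x * delta)).
  apply: continuous_max_fun; first exact: cst_continuous.
  apply: continuousB_fun => //; apply: continuousM_fun => //; exact: cst_continuous.
rewrite /spread; case: eqP => _.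
  apply: continuousM_fun => //; apply: continuousB_fun => //; exact: cst_continuous.
apply: continuousD_fun => //; apply: continuousM_fun => //; apply: continuousM_fun => //.
by move=> x; apply: (@continuous_comp _ _ _ f (fun y => zeta y v)); [exact: cf|exact: zeta_cont].
Qed.

Lemma remove_vertex :
  homotopy_equivalent R (set_type (@polyhedron R V D)) (set_type (@polyhedron R V without)).
Proof.
have sumP E (x : set_type (@polyhedron R V E)) : \sum_v val x v = 1 by case: (set_typeP x).
have subD (x : {ptws V -> R}) : polyhedron without x -> @polyhedron R V D x by move/polyhedron_without => [].
pose inc (x : set_type (@polyhedron R V without)) : set_type (@polyhedron R V D) :=
  exist _ (val x) (mem_set (subD _ (set_typeP x))).
have cinc : continuous inc by apply: continuous_set_type; exact: set_val_continuous.
have [||r [cr rE]] := @normalize_weights_continuous R (set_type (@polyhedron R V D)) V without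
    (fun x => spread (val x) 1 1).
- by move=> v; apply: spread_continuous; [exact: set_val_continuous|exact: cst_continuous..].
- by move=> x; apply: spread_without; exact: set_typeP.
(* The two stages run backwards: [l] falls from 1 to 0 on the first half while [a = 1], then [a]
   falls from 1 to 0 while [l = 0]. This joins the retraction to the identity, both on [D] and on
   [without]. *)
pose a (t : R) := Num.min (2 * (1 - t)) 1; pose l t := Num.max (2 * (1 - t) - 1) 0 : R.
have c1 (X : topologicalType) : continuous (fun p : X * R => 2 * (1 - p.2)).
  apply: continuousM_fun; first exact: cst_continuous.
  by apply: continuousB_fun; [exact: cst_continuous|exact: continuous_snd].
have cF E v : continuous (fun p : set_type (@polyhedron R V E) * R =>
    spread (val p.1) (a p.2) (l p.2) v).
  apply: spread_continuous.
  - move=> p; apply: (@continuous_comp _ _ _ fst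
      (fun x : set_type (@polyhedron R V E) => val x : {ptws V -> R})).
      exact: continuous_fst.
    exact: set_val_continuous.
  - by apply: continuous_min_fun; [exact: c1|exact: cst_continuous].
  - apply: continuous_max_fun; last exact: cst_continuous.
    by apply: continuousB_fun; [exact: c1|exact: cst_continuous].
have al t : t \in `[0, 1] -> [/\ 0 <= a t <= 1, 0 <= l t <= 1 & l t = 0 \/ a t = 1].
  rewrite in_itv /= /a /l => /andP[t0 t1].
  have [h|h] := leP (2 * (1 - t)) 1.
    have -> : Num.max (2 * (1 - t) - 1) 0 = 0 by apply: max_r; lra.
    by split; [apply/andP; split; lra|rewrite lexx ler01|left].
  have -> : Num.max (2 * (1 - t) - 1) 0 = 2 * (1 - t) - 1 by apply: max_l; lra.
  by split; [rewrite lexx ler01|apply/andP; split; lra|right].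
have [a0 l0] : a 0 = 1 /\ l 0 = 1.
  by rewrite /a /l subr0 mulr1; split; [apply: min_r|rewrite max_l]; lra.
have [a1 l1] : a 1 = 0 /\ l 1 = 0.
  by rewrite /a /l subrr mulr0; split; [apply: min_l|apply: max_r]; lra.
exists r, inc; split=> //.
- apply: (@homotopic_polyhedron R (set_type (@polyhedron R V D)) V D _ _
    (fun p => spread (val p.1) (a p.2) (l p.2))).
  + exact: cF.
  + by move=> x t /al[]; apply: spread_in; exact: set_typeP.
  + by move=> x v /=; rewrite a0 l0 -rE.
  + move=> x v /=; rewrite a1 l1; have [x0 _ _] := set_typeP x.
    under eq_bigr do rewrite spread0 //.
    by rewrite spread0 // sumP divr1.
- apply: (@homotopic_polyhedron R (set_type (@polyhedron R V without)) V without _ _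
    (fun p => spread (val p.1) (a p.2) (l p.2))).
  + exact: cF.
  + by move=> x t /al[]; apply: spread_in_without; exact: set_typeP.
  + by move=> x v /=; rewrite a0 l0 rE.
  + move=> x v /=; rewrite a1 l1; have [x0 _ _] := set_typeP x.
    under eq_bigr do rewrite spread0 //.
    by rewrite spread0 // sumP divr1.
Qed.

End VertexRemoval.

(** * Removing the unstable pairs *)

Section CyclicPairs.
Variable k : nat.
Local Notation n := k.+4.
Implicit Types (c d i j x : 'I_n) (u v w : pair2 k).

(** Cyclic successor modulo k+4, spelled out without [modn] so that linear arithmetic applies. *)
Definition csucc c d : bool :=
  (d == c.+1 :> nat)%N || ((c.+1 == n)%N && (d == 0 :> nat)%N).

Lemma csuccE c d : (d == c + 1 %[mod k + 4])%N = csucc c d.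
Proof.
rewrite /csucc addn4 addn1 (modn_small (ltn_ord d)).
have := ltn_ord c; rewrite leq_eqVlt => /orP[/eqP cn|cn].
  rewrite cn modnn eqxx /=; case: eqP => [d0|d0]; rewrite ?orbT // orbF.
  by apply/esym/negbTE; rewrite neq_ltn ltn_ord.
by rewrite modn_small // (ltn_eqF cn) orbF.
Qed.

Lemma stableP u : reflect
  (forall c d, c \in val u -> d \in val u -> c != d -> ~~ csucc c d) (stable u).
Proof.
apply: (iffP forall_inP) => [su c d cu du cd|su c cu].
  by have /forall_inP/(_ d du)/implyP/(_ cd)/andP[+ _] := su c cu; rewrite -csuccE.
apply/forall_inP => d du; apply/implyP => cd; rewrite csuccE su //=.
by rewrite eq_sym csuccE su // eq_sym.
Qed.

Lemma pair2_exists c d : c != d -> exists u, val u = [set c; d]%SET.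
Proof.
move=> cd; have cd2 : #|[set c; d]%SET| == 2%N by rewrite cards2 cd.
by exists (exist (fun A : {set 'I_n} => #|A| == 2%N) _ cd2).
Qed.

Lemma pair2P u : exists c d, c != d /\ val u = [set c; d]%SET.
Proof. exact/cards2P/(valP u). Qed.

Lemma stable2 u c d : val u = [set c; d]%SET ->
  ~~ csucc c d -> ~~ csucc d c -> stable u.
Proof.
move=> ucd cd dc; apply/stableP => x y; rewrite ucd !inE.
by move=> /orP[]/eqP-> /orP[]/eqP->; rewrite ?eqxx.
Qed.

Lemma unstable_csucc u : ~~ stable u ->
  exists i j, [/\ val u = [set i; j]%SET, i != j & csucc i j].
Proof.
have [c [d [cd ucd]]] := pair2P u.
have [cd1|ncd] := boolP (csucc c d); first by exists c, d.
have [dc1|ndc] := boolP (csucc d c).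
  by exists d, c; split=> //; rewrite 1?eq_sym // finset.setUC.
by rewrite (stable2 ucd ncd ndc).
Qed.

Lemma kneser_adjP u v :
  reflect (forall c, c \in val u -> c \notin val v) (kneser_adj u v).
Proof.
rewrite /kneser_adj setI_eq0 disjoint_subset.
apply: (iffP fintype.subsetP) => h c cu; first by have := h c cu; rewrite !inE.
by rewrite !inE h.
Qed.

Lemma common_nbr_stable (T : {set pair2 k}) w : stable w ->
  (forall u, u \in T -> kneser_adj u w) -> T \in common_nbr_sets (S2 k).
Proof.
move=> sw Tw; rewrite inE; apply/existsP; exists w; apply/forall_inP => u uT.
by rewrite /= /S2_adj /= Tw //= sw orbT.
Qed.

(* Position of [c] on the circle when counting starts at [i + 2], so that [i]
   and [i + 1] come last. *)
Definition rank i c : nat :=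
  (if i.+2 <= c then c - i.+2
   else if i.+2 <= c + n then c + n - i.+2 else c + n + n - i.+2)%N.

Lemma rank_inj i : injective (rank i).
Proof.
move=> c d cd; apply: val_inj => /=; move: cd; rewrite /rank.
have := ltn_ord c; have := ltn_ord d; have := ltn_ord i.
by case: ifP; [|case: ifP]; case: ifP => ?; try case: ifP; lia.
Qed.

Lemma rank_lt i c : (rank i c < n)%N.
Proof.
rewrite /rank; have := ltn_ord c; have := ltn_ord i.
by case: ifP; [|case: ifP]; lia.
Qed.

(** [rank i] is a rotation of the circle, so it respects cyclic succession, including the
    wrap-around from the last rank to 0. *)
Lemma rank_csucc i c d :
  csucc c d = (rank i d == (rank i c).+1) || ((rank i c).+1 == n) && (rank i d == 0%N).
Proof.
rewrite /rank /csucc; have := ltn_ord c; have := ltn_ord d; have := ltn_ord i.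
by do !case: ifP; lia.
Qed.

Lemma rank_self i : rank i i = k.+2.
Proof. by rewrite /rank; have := ltn_ord i; do !case: ifP; lia. Qed.

Lemma rank_gap i c d :
  ~~ csucc c d -> (rank i c < rank i d)%N -> ((rank i c).+2 <= rank i d)%N.
Proof. by rewrite (rank_csucc i); lia. Qed.

(** The gap rules out adjacency inside the ranking; the bound k+3 on the rank of [d] rules out
    adjacency through the wrap-around. *)
Lemma stable_rank_gap i c d u : val u = [set c; d]%SET ->
  ((rank i c).+2 <= rank i d)%N -> (rank i d < k.+3)%N -> stable u.
Proof. by move=> /stable2 su cd dk; apply: su; rewrite (rank_csucc i); lia. Qed.

Lemma rank_step i c d : csucc c d -> ((rank i c).+1 < n)%N -> rank i d = (rank i c).+1.
Proof. by rewrite (rank_csucc i); lia. Qed.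

Lemma csucc_neq c d : csucc c d -> c != d.
Proof. by apply: contraTneq => ->; rewrite /csucc; have := ltn_ord d; lia. Qed.

Lemma csucc_exists c : exists d, csucc c d.
Proof.
have [cn|cn] := ltnP c.+1 n; first by exists (Ordinal cn); rewrite /csucc eqxx.
by exists ord0; apply/orP; right; rewrite eqn_leq ltn_ord cn.
Qed.

(** [B] lists the unstable pairs that are still allowed; it will shrink from all of them to none. *)
Definition subcomplex (B : {set pair2 k}) : {pred {set pair2 k}} :=
  [pred T | (T \in common_nbr_sets (S2 k)) && (T \subset [set v | stable v] :|: B)]%SET.

Lemma subcomplex_face B (S T : {set pair2 k}) :
  S \in subcomplex B -> T \subset S -> T \in subcomplex B.
Proof.
move=> /andP[SN SB] TS; apply/andP; split; last exact: fintype.subset_trans TS SB.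
exact: common_nbr_sets_face SN TS.
Qed.

End CyclicPairs.

(** * Redistributing the mass of one unstable pair *)

Section UnstableRemoval.
Variables (R : realType) (k : nat).
Local Notation n := k.+4.
Variables (B : {set pair2 k}) (b : pair2 k) (i j : 'I_n).
Hypothesis b_ij : val b = [set i; j]%SET.
Hypothesis ij : csucc i j.

(** Chosen so that [delta] times the number of pairs is 1/2, below the bound 1 required by
    [remove_vertex]. *)
Definition delta : R := (2 * #|{: pair2 k}|%:R)^-1.

Lemma card_pair2_gt0 : (0 < #|{: pair2 k}|)%N.
Proof. by apply/card_gt0P; exists b. Qed.

Lemma delta_gt0 : 0 < delta.
Proof. by rewrite invr_gt0 mulr_gt0 // ltr0n card_pair2_gt0. Qed.

Lemma delta_lt1 : delta *+ #|{: pair2 k}| < 1.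
Proof.
rewrite -mulr_natr /delta; have := card_pair2_gt0; rewrite -(ltr0n R) => c0.
by rewrite invfM -mulrA mulVf ?gt_eqF // mulr1 invf_lt1 // ltr1n.
Qed.

(** A continuous test for little mass at [c]: positive exactly when the pairs containing [c] have
    total mass below [delta]. *)
Definition slack (y : pair2 k -> R) (c : 'I_n) : R :=
  Num.max 0 (delta - \sum_(v : pair2 k | c \in val v) y v).

(* The vertex [{i, x}] gets a positive weight iff [x] lies strictly between two
   points of positive slack. *)
Definition zeta (y : pair2 k -> R) (v : pair2 k) : R :=
  if stable v && (i \in val v) then
    \sum_(x in val v | x != i)
      (\sum_(c | (rank i c < rank i x)%N) slack y c) *
      (\sum_(d | (rank i x < rank i d)%N) slack y d)
  else 0.

Lemma slack_ge0 y c : 0 <= slack y c.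
Proof. by rewrite le_max lexx. Qed.

Lemma zeta_ge0 y v : 0 <= zeta y v.
Proof.
rewrite /zeta; case: ifP => // _; apply: sumr_ge0 => x _.
by apply: mulr_ge0; apply: sumr_ge0 => c _; exact: slack_ge0.
Qed.

Lemma slack_continuous c : continuous (fun y : {ptws pair2 k -> R} => slack y c).
Proof.
apply: continuous_max_fun; first exact: cst_continuous.
apply: continuousB_fun; first exact: cst_continuous.
by apply: continuous_sum_fun => v _; exact: (@proj_continuous (pair2 k) (fun=> R) v).
Qed.

Lemma zeta_continuous v : continuous (fun y : {ptws pair2 k -> R} => zeta y v).
Proof.
rewrite /zeta; case: (stable v && _); last exact: cst_continuous.
apply: continuous_sum_fun => x _; apply: continuousM_fun;
  by apply: continuous_sum_fun => c _; exact: slack_continuous.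
Qed.

(** A single pair of mass above [delta] through [c] would already exhaust the slack at [c]. *)
Lemma slack_gt0 (y : pair2 k -> R) (c : 'I_n) (v : pair2 k) : (forall u, 0 <= y u) -> 0 < slack y c -> delta < y v ->
  c \notin val v.
Proof.
move=> y0 yc yv; apply: contraL yc => cv; rewrite -leNgt /slack ge_max lexx /=.
rewrite subr_le0 (bigD1 v) //= (le_trans (ltW yv)) // lerDl.
by apply: sumr_ge0 => u _; exact: y0.
Qed.

Lemma slack_out (y : pair2 k -> R) (c : 'I_n) : (forall v : pair2 k, c \in val v -> y v = 0) -> 0 < slack y c.
Proof.
move=> yc; have -> : slack y c = Num.max 0 (delta - 0).
  by congr (Num.max 0 (delta - _)); exact: big1.
by rewrite subr0 lt_max delta_gt0 orbT.
Qed.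

(** The two points [i] and [j] of [b] occupy the last two ranks, k+2 and k+3. *)
Lemma rank_lt_b c : c \notin val b -> (rank i c < k.+2)%N.
Proof.
move=> cb; rewrite ltnNge; apply: contra cb => ci.
have := rank_csucc i i j; rewrite ij rank_self /= => /esym.
rewrite [_ == n]eqn_leq ltnn andbF orbF => /eqP rj.
have := rank_lt i c; rewrite !ltnS b_ij !inE; move: ci.
rewrite leq_eqVlt => /orP[/eqP ci _|ci ci'].
  by apply/orP; left; apply/eqP/(@rank_inj _ i); rewrite rank_self.
apply/orP; right; apply/eqP/(@rank_inj _ i); rewrite rj; apply/eqP.
by rewrite eqn_leq ci' ci.
Qed.

Lemma rank_i_notin c : (rank i c < k.+2)%N -> c != i.
Proof. by apply: contraTneq => ->; rewrite rank_self ltnn. Qed.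

Lemma zeta_gt0P y v : 0 < zeta y v ->
  exists x c d, [/\ stable v, val v = [set i; x]%SET,
    0 < slack y c & 0 < slack y d] /\ (rank i c < rank i x < rank i d)%N.
Proof.
rewrite /zeta; case: ifP => [/andP[sv iv]|]; last by rewrite ltxx.
have s0 (P : pred 'I_n) : 0 <= \sum_(c | P c) slack y c.
  by apply: sumr_ge0 => c _; exact: slack_ge0.
move=> /sum_gt0P[x|x /andP[xv xi]]; first by rewrite mulr_ge0.
rewrite mulr_ge0_gt0 // => /andP[/sum_gt0P[c|c cx sc]]; first exact: slack_ge0.
move=> /sum_gt0P[d|d dx sd]; first exact: slack_ge0.
exists x, c, d; rewrite cx dx; do 2!split=> //.
apply/eqP; rewrite eq_sym eqEcard (eqP (valP v)) cards2 eq_sym xi.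
by rewrite finset.subUset !finset.sub1set iv xv.
Qed.

(** As [b] is unstable and lies in the support, a common neighbour of the support must be stable.
    Its two points lie in no pair carrying mass, so they have slack; they avoid [b], and stability
    separates their ranks. *)
Lemma support_edge y : polyhedron (subcomplex B) y -> delta < y b ->
  exists c d, [/\ ((rank i c).+2 <= rank i d)%N, (rank i d < k.+2)%N,
    0 < slack y c & 0 < slack y d].
Proof.
move=> [y0 _ /andP[yN _]] yb; move: yN; rewrite inE => /existsP[w /forall_inP yw].
have bw : S2 k b w by apply: yw; rewrite inE gt_eqF // (lt_trans delta_gt0).
have nsb : ~~ stable b.
  apply/stableP => sb; have := sb i j; rewrite b_ij !inE !eqxx orbT => /(_ isT isT).
  have ij' := csucc_neq ij.
  by rewrite ij ij' => /(_ isT).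
have sw : stable w by move: bw => /andP[_]; rewrite (negbTE nsb).
have yw0 (v : pair2 k) (c : 'I_n) : c \in val w -> c \in val v -> y v = 0.
  move=> cw cv; apply/eqP; apply: contraLR cw => yv.
  have /andP[/kneser_adjP vw _] : S2 k v w by apply: yw; rewrite inE.
  exact: vw.
have wb (c : 'I_n) : c \in val w -> (rank i c < k.+2)%N.
  move=> cw; apply: rank_lt_b; apply: contraL cw.
  by case/andP: bw => /kneser_adjP + _; exact.
have sl (c : 'I_n) : c \in val w -> 0 < slack y c.
  by move=> cw; apply: slack_out => v; exact: yw0.
have [c [d [cd wcd]]] := pair2P w.
have cw : c \in val w by rewrite wcd !inE eqxx.
have dw : d \in val w by rewrite wcd !inE eqxx orbT.
have /stableP st := sw.
have aux (x z : 'I_n) : x \in val w -> z \in val w -> (rank i x < rank i z)%N ->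
    ((rank i x).+2 <= rank i z)%N.
  move=> xw zw xz; have xz' : x != z by apply: contraTneq xz => ->; rewrite ltnn.
  by apply: rank_gap => //; exact: st.
have [rcd|rdc|] := ltngtP (rank i c) (rank i d).
- by exists c, d; split; [exact: aux|exact: wb|exact: sl..].
- by exists d, c; split; [exact: aux|exact: wb|exact: sl..].
- by move/rank_inj => cd'; rewrite cd' eqxx in cd.
Qed.

(** Let [c0] and [d0] be the points of positive slack of lowest and highest rank. The stable pair
    formed by them is a common neighbour: slack keeps it off the heavy pairs, in particular off [i],
    and each [x] used by [zeta] lies strictly between two points of positive slack, hence strictly
    between [c0] and [d0]. *)
Lemma zetaD y : polyhedron (subcomplex B) y -> delta < y b ->
  [set v | (delta < y v) || (0 < zeta y v)]%SET \in subcomplex B.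
Proof.
move=> yD yb; have [y0 _ /andP[_ /fintype.subsetP ysub]] := yD.
have [c [d [cd dk sc sd]]] := support_edge yD yb.
case: (@arg_minnP _ c (fun x => 0 < slack y x) (rank i) sc) => c0 sc0 c0min.
case: (@arg_maxnP _ d (fun x => 0 < slack y x) (rank i) sd) => d0 sd0 d0max.
have sb (x : 'I_n) : 0 < slack y x -> x \notin val b by move=> sx; exact: slack_gt0 sx yb.
have d0k := rank_lt_b (sb _ sd0).
have c0d0 : ((rank i c0).+2 <= rank i d0)%N.
  by rewrite (leq_trans _ (d0max _ sd)) // (leq_trans _ cd) // !ltnS c0min.
have c0d0' : c0 != d0 by apply: contraTneq c0d0 => ->; rewrite -ltnNge ltnS leqnSn.
have [w wE] := pair2_exists c0d0'.
have sw : stable w by apply: (stable_rank_gap wE c0d0); exact: ltnW.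
apply/andP; split; last first.
  apply/fintype.subsetP => v; rewrite inE => /orP[yv|].
    by apply: ysub; rewrite inE gt_eqF // (lt_trans delta_gt0).
  by move=> /zeta_gt0P[x [? [? [[sv _ _ _] _]]]]; rewrite !inE sv.
apply: (common_nbr_stable sw) => v; rewrite inE => /orP[yv|].
  apply/kneser_adjP => x xv; rewrite wE !inE; apply/negP => /orP[]/eqP xE.
  - by have := slack_gt0 y0 sc0 yv; rewrite -xE xv.
  - by have := slack_gt0 y0 sd0 yv; rewrite -xE xv.
move=> /zeta_gt0P[x [c' [d' [[_ vE sc' sd'] /andP[cx xd]]]]].
have := c0min _ sc'; have := d0max _ sd' => d0' c0'.
apply/kneser_adjP => z; rewrite vE wE !inE => /orP[]/eqP->.
- apply/negP => /orP[]/eqP iE; first by have := sb _ sc0; rewrite -iE b_ij !inE eqxx.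
  by have := sb _ sd0; rewrite -iE b_ij !inE eqxx.
- apply/negP => /orP[]/eqP xE.
    by have := leq_ltn_trans c0' cx; rewrite xE ltnn.
  by have := leq_trans xd d0'; rewrite xE ltnn.
Qed.

Lemma zeta_pos y : polyhedron (subcomplex B) y -> delta < y b ->
  exists2 v, v != b & 0 < zeta y v.
Proof.
move=> yD yb; have [c [d [cd dk sc sd]]] := support_edge yD yb.
(* The point just after [c] lies strictly before [d], since their ranks differ by at least 2. Its
   rank is at most k while that of [i] is k+2, so [i] and [x] form a stable pair. *)
have [x cx] := csucc_exists c.
have rx : rank i x = (rank i c).+1.
  by apply: rank_step cx _; rewrite (leq_ltn_trans _ (rank_lt i d)) // ltnW.
have rxk : (rank i x < k.+1)%N by rewrite rx -ltnS (leq_trans _ dk).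
have ix : i != x by rewrite eq_sym rank_i_notin // ltnW.
have [v vE] := pair2_exists ix.
have sv : stable v.
  by rewrite finset.setUC in vE; apply: (stable_rank_gap (i := i) vE); rewrite rank_self.
exists v.
  apply: contraTneq sv => ->; apply/stableP => /(_ i j); rewrite b_ij !inE !eqxx orbT.
  have ij' := csucc_neq ij.
  by move=> /(_ isT isT ij'); rewrite ij.
rewrite /zeta sv vE !inE eqxx /=.
apply: (@sum_gt0 R _ _ _ x).
- by move=> z; rewrite mulr_ge0 // sumr_ge0 // => u _; exact: slack_ge0.
- by rewrite !inE eqxx orbT eq_sym.
- rewrite mulr_gt0 //.
  + by apply: (@sum_gt0 R _ _ _ c) => //; [move=> z; exact: slack_ge0|rewrite rx].
  + by apply: (@sum_gt0 R _ _ _ d) => //; [move=> z; exact: slack_ge0|rewrite rx].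
Qed.

End UnstableRemoval.

Lemma remove_unstable (R : realType) (k : nat) (B : {set pair2 k}) (b : pair2 k) :
  ~~ stable b ->
  homotopy_equivalent R
    (set_type (@polyhedron R _ (subcomplex B)))
    (set_type (@polyhedron R _ (subcomplex (B :\ b)%SET))).
Proof.
move=> nsb; have [i [j [bij _ ij]]] := unstable_csucc nsb.
have -> : subcomplex (B :\ b)%SET = without (subcomplex B) b.
  apply/funext => T; rewrite /without /= /subcomplex /= -andbA; congr andb.
  apply/fintype.subsetP/andP => [TB|[/fintype.subsetP TB bT] v vT].
    split; first by apply/fintype.subsetP => v /TB; rewrite !inE => /orP[->//|/andP[_ ->]]; rewrite orbT.
    by apply: contra nsb => /TB; rewrite !inE eqxx /= orbF.
  have := TB v vT; rewrite !inE => /orP[->//|->]; rewrite andbT.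
  by apply/orP; right; apply: contraNneq bT => <-.
apply: (@remove_vertex R _ (subcomplex B) b (delta R k) (zeta i)).
- exact: subcomplex_face.
- exact: delta_gt0.
- exact: delta_lt1.
- exact: zeta_continuous.
- exact: zeta_ge0.
- exact: zetaD bij ij.
- exact: zeta_pos bij ij.
Qed.

(** * Alternating values of polynomials *)

Section FiniteDifferences.
Variable R : realType.
Implicit Types (p : {poly R}) (a : nat -> R).

(** Pascal's rule, read as the recursion for iterated finite differences. *)
Lemma alt_binomial_sumS N a :
  \sum_(i < N.+2) (-1) ^+ i * 'C(N.+1, i)%:R * a i =
  \sum_(i < N.+1) (-1) ^+ i * 'C(N, i)%:R * a i -
  \sum_(i < N.+1) (-1) ^+ i * 'C(N, i)%:R * a i.+1.
Proof.
have -> : \sum_(i < N.+1) (-1) ^+ i * 'C(N, i)%:R * a i =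
    \sum_(i < N.+2) (-1) ^+ i * 'C(N, i)%:R * a i.
  by rewrite [RHS]big_ord_recr /= bin_small // mulr0 mul0r addr0.
rewrite big_ord_recl [X in _ = X - _]big_ord_recl /= !bin0 -addrA; congr (_ + _).
rewrite -sumrB; apply: eq_bigr => i _; rewrite /bump /= add1n binS natrD exprS; ring.
Qed.

(** The shift does not change the leading coefficient, so the top terms cancel. *)
Lemma size_sub_shift p N : (size p <= N.+1)%N -> (size (p - (p \Po ('X + 1)))%R <= N)%N.
Proof.
move=> pN; have sX : size ('X + 1 : {poly R}) = 2 by rewrite size_XaddC.
have sp : size (p \Po ('X + 1)) = size p by exact: size_comp_poly2.
apply/leq_sizeP => m; rewrite leq_eqVlt => /orP[/eqP <-|Nm]; last first.
  by rewrite coefB !nth_default ?subrr // ?sp (leq_trans pN).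
move: pN; rewrite coefB leq_eqVlt => /orP[/eqP spN|pN]; last first.
  by rewrite !nth_default ?subrr // ?sp.
have -> : p`_N = lead_coef p by rewrite lead_coefE spN.
have -> : (p \Po ('X + 1))`_N = lead_coef (p \Po ('X + 1)) by rewrite lead_coefE sp spN.
by rewrite lead_coef_comp ?sX // lead_coefXaddC expr1n mulr1 subrr.
Qed.

(** The N-th finite difference kills degrees below N: by induction, each difference lowers the
    degree by one. *)
Lemma alt_binomial_sum p N : (size p <= N)%N ->
  \sum_(i < N.+1) (-1) ^+ i * 'C(N, i)%:R * p.[i%:R] = 0.
Proof.
elim: N p => [|N IHN] p pN.
  by move: pN; rewrite leqn0 size_poly_eq0 => /eqP->; rewrite big1 // => i _; rewrite horner0 mulr0.
rewrite (alt_binomial_sumS N (fun i => p.[i%:R])) -sumrB.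
rewrite -[RHS](IHN _ (size_sub_shift pN)); apply: eq_bigr => i _.
by rewrite -mulrBr hornerD hornerN horner_comp !hornerE -natr1.
Qed.

End FiniteDifferences.

(** * Sign patterns of alternating values at k+4 points *)

Section Alternating.
Variables (R : realType) (k : nat).
Local Notation n := k.+4.
Implicit Types (x : 'rV[R]_k.+1) (c d i j : 'I_n).

Definition altern x c : R := (-1) ^+ c * (rVpoly x).[c%:R].

Lemma alternD x y c : altern (x + y) c = altern x c + altern y c.
Proof. by rewrite /altern linearD hornerD mulrDr. Qed.

Lemma alternZ a x c : altern (a *: x) c = a * altern x c.
Proof. by rewrite /altern linearZ hornerZ /= mulrCA. Qed.

Lemma altern0 c : altern 0 c = 0.
Proof. by rewrite -(scale0r 0) alternZ mul0r. Qed.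

Lemma altern_sum (I : finType) (F : I -> 'rV[R]_k.+1) c :
  altern (\sum_i F i) c = \sum_i altern (F i) c.
Proof. by apply: (big_morph (fun x => altern x c)); [move=> x y; exact: alternD|exact: altern0]. Qed.

Lemma altern_continuous c : continuous (fun x => altern x c).
Proof.
have -> : (fun x => altern x c) = (fun x => \sum_m x ord0 m * altern (delta_mx ord0 m) c).
  apply/funext => x; rewrite {1}(row_sum_delta x) altern_sum.
  by apply: eq_bigr => m _; rewrite alternZ.
apply: continuous_sum_fun => m _; apply: continuousM_fun; last exact: cst_continuous.
exact: coord_continuous.
Qed.

(** Multiply by a quadratic [q] that vanishes at [i] and [j] and is positive at the other points.
    The alternating binomial sum of the product is 0 because its degree is at most k+2, yet all its
    terms are nonpositive. Hence all of them vanish, which gives too many roots. *)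
Lemma altern_neq0 x i j : csucc i j -> x != 0 ->
  (forall c, c != i -> c != j -> altern x c <= 0) -> False.
Proof.
move=> ij x0 neg.
(* When [i] and [j] are consecutive integers, the product of the linear factors is positive at the
   other points; in the wrap-around case [i = k+3], [j = 0] it is negative there. *)
pose e : R := if (i < j)%N then 1 else -1.
pose q := e *: (('X - i%:R%:P) * ('X - j%:R%:P)) : {poly R}.
have qE (c : 'I_n) : q.[c%:R] = e * ((c%:R - i%:R) * (c%:R - j%:R)) by rewrite !hornerE.
have q_gt0 c : c != i -> c != j -> 0 < q.[c%:R].
  move=> ci cj; rewrite qE /e; have {}ci : (c != i :> nat) := ci.
  have {}cj : (c != j :> nat) := cj; have := ltn_ord c; have := ltn_ord i.
  move: ij; rewrite /csucc; case: (ltnP i j) => ij /orP[/eqP ji|/andP[/eqP iE /eqP jE]] il cl; try lia.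
  - rewrite mul1r; have [ci'|ci'] := ltnP c i.
      by rewrite nmulr_rgt0 subr_lt0 ltr_nat //; lia.
    by rewrite mulr_gt0 // subr_gt0 ltr_nat; lia.
  - rewrite mulN1r oppr_gt0 nmulr_rlt0 ?subr_lt0 ?subr_gt0 ltr_nat; lia.
have sz : (size (rVpoly x * q)%R <= k.+3)%N.
  apply: (leq_trans (size_polyMleq _ _)).
  have sx : (size (rVpoly x) <= k.+1)%N by exact: size_poly.
  have sq : (size q <= 3)%N.
    apply: (leq_trans (size_scale_leq _ _)); apply: (leq_trans (size_polyMleq _ _)).
    by rewrite !size_XsubC.
  lia.
have sum0 := alt_binomial_sum sz.
have x_root c : c != i -> c != j -> altern x c = 0.
  move=> ci cj.
  pose t (d : 'I_n) : R := - (altern x d * ('C(k.+3, d)%:R * q.[d%:R])).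
  have t0 d : 0 <= t d.
    rewrite /t oppr_ge0.
    have [->|di] := eqVneq d i; first by rewrite qE subrr mul0r !mulr0.
    have [->|dj] := eqVneq d j; first by rewrite qE subrr !mulr0.
    by rewrite mulr_le0_ge0 ?neg // mulr_ge0 // ltW // q_gt0.
  have : \sum_d t d == 0.
    rewrite sumrN oppr_eq0; apply/eqP; rewrite -[RHS]sum0; apply: eq_bigr => d _.
    rewrite /altern hornerM; ring.
  rewrite psumr_eq0 // => /allP/(_ c); rewrite mem_index_enum => /(_ isT) /=.
  rewrite /t oppr_eq0 !mulf_eq0 pnatr_eq0 (gt_eqF (q_gt0 _ ci cj)) orbF.
  have -> : ('C(k.+3, c) == 0)%N = false.
    by apply/negbTE; rewrite -lt0n bin_gt0 -ltnS ltn_ord.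
  by rewrite orbF -mulf_eq0 => /eqP.
(* These are k+2 distinct roots, whereas the degree is at most k. *)
pose rs := [seq (c : 'I_n)%:R | c <- enum (~: [set i; j]%SET)] : seq R.
have xp : rVpoly x != 0.
  by apply: contra x0 => /eqP x0; rewrite -(rVpolyK x) x0 linear0.
have : (size rs < size (rVpoly x))%N.
  apply: max_poly_roots => //.
    apply/allP => _ /mapP[c + ->]; rewrite mem_enum !inE negb_or => /andP[ci cj].
    have /eqP := x_root _ ci cj; rewrite /altern mulf_eq0 => /orP[|//].
    by rewrite expf_eq0 oppr_eq0 oner_eq0 andbF.
  rewrite map_inj_uniq ?enum_uniq // => c d /eqP; rewrite eqr_nat => /eqP.
  exact: val_inj.
rewrite size_map -cardE cardsCs finset.setCK cards2 (csucc_neq ij) card_ord.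
by rewrite ltnNge (leq_trans (size_poly _ _)) //; lia.
Qed.

(** If no such stable pair existed, any two positive points would be cyclically adjacent. Among at
    least four points on a circle no three are pairwise adjacent, so all positive points would lie
    in one adjacent pair, against [altern_neq0]. *)
Lemma altern_stable x : x != 0 ->
  exists v : pair2 k, stable v /\ forall c, c \in val v -> 0 < altern x c.
Proof.
move=> x0; apply: contrapT => nost.
have adj c d : 0 < altern x c -> 0 < altern x d -> c != d -> csucc c d || csucc d c.
  move=> xc xd cd; apply/negPn; rewrite negb_or; apply/negP => /andP[ncd ndc].
  have [v vE] := pair2_exists cd; apply: nost; exists v.
  split; first exact: (stable2 vE).
  by move=> z; rewrite vE !inE => /orP[]/eqP->.
have [i [j [ij neg]]] : exists i j, csucc i j /\
    forall c, c != i -> c != j -> altern x c <= 0.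
  have [c xc|xle] := pickP [pred c | 0 < altern x c]; last first.
    have [j ij] := csucc_exists (ord0 : 'I_n); exists ord0, j; split=> // c _ _.
    by rewrite leNgt -[_ < _]/([pred c | 0 < altern x c] c) xle.
  rewrite /= in xc.
  have two (i j : 'I_n) : csucc i j -> 0 < altern x i -> 0 < altern x j ->
      forall e, e != i -> e != j -> altern x e <= 0.
    move=> ij xi xj e ei ej; rewrite leNgt; apply/negP => xe.
    have := adj _ _ xe xi ei; have := adj _ _ xe xj ej; have := csucc_neq ij.
    move: ij ei ej; rewrite -!(inj_eq val_inj) /csucc /=.
    have := ltn_ord i; have := ltn_ord j; have := ltn_ord e; clear; lia.
  have [d /andP[dc xd]|xle] := pickP [pred d | (d != c) && (0 < altern x d)].
    case/orP: (adj _ _ xd xc dc) => h.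
      by exists d, c; split=> //; exact: two.
    by exists c, d; split=> //; exact: two.
  have [j ij] := csucc_exists c; exists c, j; split=> // d dc _.
  by rewrite leNgt; apply/negP => xd; have := xle d; rewrite /= dc xd.
exact: altern_neq0 ij x0 neg.
Qed.

(** One root in the middle of each gap between [g] and [g+1], so that no integer point is a root. *)
Definition half_roots (Z : seq nat) : {poly R} :=
  \prod_(g <- Z) ('X - (g%:R + 2^-1)%:P).

(** The negative factors at [m] are those whose root [g+1/2] lies to the right of [m], that is,
    those with [m <= g]. *)
Lemma half_roots_sign (Z : seq nat) (m : nat) :
  0 < (-1) ^+ count (leq m) Z * (half_roots Z).[m%:R].
Proof.
rewrite /half_roots; elim: Z => [|g Z IHZ]; first by rewrite big_nil hornerC mulr1.
rewrite big_cons hornerM hornerXsubC /= exprD mulrACA mulr_gt0 //.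
have [mg|gm] := leqP m g.
  rewrite expr1 mulN1r oppr_gt0 subr_lt0 ltr_pwDr ?invr_gt0 //.
  by rewrite ler_nat.
rewrite expr0 mul1r subr_gt0; apply: lt_le_trans (_ : g.+1%:R <= _); last by rewrite ler_nat.
by rewrite -[g.+1]addn1 natrD; lra.
Qed.

Lemma count_leqS (Z : seq nat) (m : nat) : uniq Z ->
  count (leq m) Z = ((m \in Z) + count (leq m.+1) Z)%N.
Proof.
move=> uZ; rewrite -count_uniq_mem //; elim: Z {uZ} => //= g Z ->.
by rewrite (leq_eqVlt m g) (eq_sym m); case: eqP => [->|_]; rewrite ?ltnn /=; lia.
Qed.

(* The polynomial vanishes in the gap between two consecutive points exactly
   when neither of them is in [v], so that the alternating values change sign
   only around the points of [v]; as [v] is stable, at least three of the k+3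
   gaps touch [v], which bounds the degree by k. *)
Lemma stable_altern (v : pair2 k) : stable v ->
  exists x, forall c, c \notin val v -> altern x c < 0.
Proof.
move=> /stableP sv.
have [c [d [cd dv vE]]] : exists c d : 'I_n,
    [/\ (c.+2 <= d)%N, (0 < c)%N || (d.+1 < n)%N & val v = [set c; d]%SET].
  have [c [d [cd vE]]] := pair2P v.
  have cv : c \in val v by rewrite vE !inE eqxx.
  have dv : d \in val v by rewrite vE !inE eqxx orbT.
  have dc : d != c by rewrite eq_sym.
  have {sv cv dv} [h1 h2] := conj (sv _ _ cv dv cd) (sv _ _ dv cv dc).
  rewrite /csucc in h1 h2; have cn := ltn_ord c; have dn := ltn_ord d.
  have [cd'|dc'|cd'] := ltngtP c d; last by rewrite (val_inj cd') eqxx in cd.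
  - exists c, d; split=> //; move: h1 h2 cd' cn dn; clear; lia.
  - exists d, c; rewrite finset.setUC; split=> //; move: h1 h2 dc' cn dn; clear; lia.
pose inV (m : nat) := (m == c) || (m == d).
have inVE (z : 'I_n) : inV z = (z \in val v) by rewrite vE !inE.
pose Z := [seq g <- iota 0 k.+3 | ~~ (inV g || inV g.+1)].
have uZ : uniq Z by rewrite filter_uniq // iota_uniq.
have sZ : (size Z <= k)%N.
  rewrite size_filter; have := count_predC (fun g => ~~ (inV g || inV g.+1)) (iota 0 k.+3).
  rewrite size_iota.
  suff : (3 <= count (predC (fun g => ~~ (inV g || inV g.+1))) (iota 0 k.+3))%N by lia.
  (* Three distinct gaps touching [v]: the one after [c], the one before [d], and an outer one,
     before [c] or, if [c] is 0, after [d]. *)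
  rewrite -size_filter; pose g3 := if (0 < c)%N then c.-1 else d : nat.
  apply: (@uniq_leq_size _ [:: c : nat; d.-1; g3]).
    rewrite /= !inE /g3; move: cd dv; clear; case: (ltnP 0 c); lia.
  move=> g; rewrite !inE mem_filter mem_iota /= /inV negbK /g3.
  by move: cd dv; have := ltn_ord d; clear; case: (ltnP 0 c); lia.
(* The parity of [m + count (leq m) Z] is the sign of the alternating value of [half_roots Z] at
   [m]. It changes from [m] to [m+1] exactly when the gap has no root, that is, when one of the two
   points is in [v]; adding [inV] compensates for this. *)
have step m : (m.+1 < n)%N ->
    odd (m + count (leq m) Z) (+) inV m = odd (m.+1 + count (leq m.+1) Z) (+) inV m.+1.
  move=> mn; rewrite (count_leqS m uZ) mem_filter mem_iota /= add0n.
  have -> : (m < k.+3)%N by [].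
  have : ~~ (inV m && inV m.+1) by rewrite /inV; move: cd; clear; lia.
  rewrite andbT !oddD /=; case: (inV m); case: (inV m.+1) => //= _;
    by case: (odd m); case: (odd (count _ _)).
have const m : (m < n)%N -> odd (m + count (leq m) Z) (+) inV m = odd (count (leq 0) Z) (+) inV 0.
  by elim: m => [|m IHm] mn; rewrite ?add0n // -step // IHm // ltnW.
(* Outside [v] the sign is thus constantly [(-1) ^+ e]; one more sign in the witness makes the
   values negative. *)
set e := odd (count (leq 0) Z) (+) inV 0 in const.
exists (poly_rV ((-1) ^+ e.+1 *: half_roots Z)) => z zv.
rewrite /altern poly_rV_K; last first.
  by apply: (leq_trans (size_scale_leq _ _)); rewrite size_prod_XsubC.
rewrite hornerZ exprS mulN1r mulNr mulrN oppr_lt0 mulrA.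
have := half_roots_sign Z z; congr (0 < _ * _).
have := const _ (ltn_ord z); rewrite inVE (negbTE zv) addbF => <-.
by rewrite signr_odd exprD mulrA -expr2 sqrr_sign mul1r.
Qed.

End Alternating.

(** * The stable part is a sphere *)

Section StableSphere.
Variables (R : realType) (k : nat).
Local Notation n := k.+4.
Local Notation D := (subcomplex (finset.set0 : {set pair2 k})).
Implicit Types (x : 'rV[R]_k.+1) (y : {ptws pair2 k -> R}) (c : 'I_n) (v w : pair2 k).

Lemma weighted_sum_lt0 (I : finType) (y a : I -> R) :
  (forall i, 0 <= y i) -> \sum_i y i = 1 -> (forall i, y i != 0 -> a i < 0) ->
  \sum_i y i * a i < 0.
Proof.
move=> y0 y1 a0; rewrite -oppr_gt0 -sumrN.
have [i _ yi] : exists2 i, xpredT i & 0 < y i.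
  by apply: sum_gt0P => //; rewrite y1 ltr01.
have t0 j : 0 <= - (y j * a j).
  have [->|yj] := eqVneq (y j) 0; first by rewrite mul0r oppr0.
  by rewrite oppr_ge0 mulr_ge0_le0 // ltW // a0.
by apply: (@sum_gt0 R _ _ _ i) => //; rewrite oppr_gt0 pmulr_rlt0 // a0 // gt_eqF.
Qed.

Variable u : pair2 k -> 'rV[R]_k.+1.
Hypothesis uP : forall v, stable v -> forall c, c \notin val v -> altern (u v) c < 0.

Definition moment (y : {ptws pair2 k -> R}) : 'rV[R]_k.+1 := \sum_v y v *: u v.

Lemma altern_moment y c : altern (moment y) c = \sum_v y v * altern (u v) c.
Proof. by rewrite altern_sum; apply: eq_bigr => v _; rewrite alternZ. Qed.

Lemma moment_continuous : continuous moment.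
Proof.
apply: continuous_big => [x|v _ y]; first by apply: cvgD; [exact: cvg_fst|exact: cvg_snd].
have cv : (fun z : {ptws pair2 k -> R} => z v) z @[z --> y] --> y v.
  exact: (@proj_continuous (pair2 k) (fun=> R) v).
exact: (cvgZ cv (cvg_cst (u v))).
Qed.

Lemma stable_support y : polyhedron D y ->
  exists w : pair2 k, forall v, y v != 0 -> stable v /\ kneser_adj v w.
Proof.
move=> [_ _ /andP[yN /fintype.subsetP yS]]; move: yN; rewrite inE.
move=> /existsP[w /forall_inP yw]; exists w => v yv; split.
  by have := yS v; rewrite !inE orbF; exact.
by have /andP[] : S2 k v w by apply: yw; rewrite inE.
Qed.

Lemma altern_moment_lt0 y (c : 'I_n) : polyhedron D y ->
  (forall v : pair2 k, y v != 0 -> c \notin val v) -> altern (moment y) c < 0.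
Proof.
move=> yD yc; have [w yw] := stable_support yD; have [y0 y1 _] := yD.
rewrite altern_moment; apply: weighted_sum_lt0 => // v yv.
by apply: uP; [case: (yw v yv)|exact: yc].
Qed.

Definition positive_pairs (x : 'rV[R]_k.+1) (v : pair2 k) : R :=
  if stable v then \prod_(c in val v) Num.max 0 (altern x c) else 0.

Lemma positive_pairs_ge0 x v : 0 <= positive_pairs x v.
Proof.
rewrite /positive_pairs; case: ifP => // _.
by apply: prodr_ge0 => c _; rewrite le_max lexx.
Qed.

Lemma positive_pairs_continuous v : continuous (fun x => positive_pairs x v).
Proof.
rewrite /positive_pairs; case: (stable v); last exact: cst_continuous.
apply: continuous_prod_fun => c _; apply: continuous_max_fun; first exact: cst_continuous.
exact: altern_continuous.
Qed.

Lemma positive_pairs_neq0 x v : positive_pairs x v != 0 ->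
  stable v /\ forall c, c \in val v -> 0 < altern x c.
Proof.
rewrite /positive_pairs; case: ifP => [sv|_]; last by rewrite eqxx.
move=> /prodf_neq0 h; split=> // c cv; have := h c cv.
by rewrite neq_lt ltNge le_max lexx /= lt_max ltxx.
Qed.

Lemma positive_pairs_exists x : x != 0 -> exists v, 0 < positive_pairs x v.
Proof.
move=> /altern_stable[v [sv vx]]; exists v; rewrite /positive_pairs sv.
by apply: prodr_gt0 => c cv; rewrite lt_max vx // orbT.
Qed.

(** This is [altern_stable] applied to [- x]. *)
Lemma altern_negative x : x != 0 ->
  exists w : pair2 k, forall c, c \in val w -> altern x c < 0.
Proof.
rewrite -oppr_eq0 => /altern_stable[w [_ wx]]; exists w => c /wx.
by rewrite -scaleN1r alternZ mulN1r oppr_gt0.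
Qed.

Lemma subcomplex_kneser (T : {set pair2 k}) w :
  (forall v, v \in T -> stable v /\ kneser_adj v w) -> T \in D.
Proof.
move=> Tw; apply/andP; split; last first.
  by apply/fintype.subsetP => v /Tw[sv _]; rewrite !inE sv.
rewrite inE; apply/existsP; exists w; apply/forall_inP => v /Tw[sv vw].
by rewrite /= /S2_adj /= vw sv.
Qed.

Lemma negative_kneser x v w : positive_pairs x v != 0 ->
  (forall c, c \in val w -> altern x c < 0) -> stable v /\ kneser_adj v w.
Proof.
move=> /positive_pairs_neq0[sv vx] wx; split=> //; apply/kneser_adjP => c /vx xc.
by apply/negP => /wx; rewrite ltNge ltW.
Qed.

Lemma positive_pairs_in x : x != 0 -> weights_in D (positive_pairs x).
Proof.
move=> x0; split; [exact: positive_pairs_ge0|exact: positive_pairs_exists|].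
have [w wx] := altern_negative x0; apply: (@subcomplex_kneser _ w) => v.
by rewrite inE => /negative_kneser; exact.
Qed.

(** A common neighbour [w] of the support misses every pair [v] carrying mass, so each such [u v] is
    negative on [w], and so is their weighted average. *)
Lemma moment_neg y : polyhedron D y -> exists w : pair2 k,
  (forall v, y v != 0 -> stable v /\ kneser_adj v w) /\
  (forall c, c \in val w -> altern (moment y) c < 0).
Proof.
move=> yD; have [w yw] := stable_support yD; exists w; split=> // c cw.
apply: altern_moment_lt0 => // v /yw[_ /kneser_adjP vw].
by apply: contraL cw => /vw.
Qed.

Lemma altern_lt0_neq0 x c : altern x c < 0 -> x != 0.
Proof. by apply: contraTneq => ->; rewrite altern0 ltxx. Qed.

Lemma moment_neq0 y : polyhedron D y -> moment y != 0.
Proof.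
move=> /moment_neg[w [_ wy]]; have [c [d [_ wE]]] := pair2P w.
by apply: (@altern_lt0_neq0 _ c); apply: wy; rewrite wE !inE eqxx.
Qed.

Lemma subcomplex_stable_sphere :
  homotopy_equivalent R (set_type (@polyhedron R _ D)) (set_type (sphere R k)).
Proof.
have sumP (x : set_type (@polyhedron R _ D)) : \sum_v val x v = 1 by case: (set_typeP x).
have [||f [cf fE]] := @normalize_sphere_continuous R k (set_type (@polyhedron R _ D))
    (fun z => moment (val z)).
- move=> y; apply: continuous_comp; first exact: set_val_continuous.
  exact: moment_continuous.
- by move=> y; apply: moment_neq0; exact: set_typeP.
have x_neq0 (z : set_type (sphere R k)) : val z != 0.
  exact: (sphere_neq0 (set_typeP z)).
have [||g [cg gE]] := @normalize_weights_continuous R (set_type (sphere R k)) _ D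
    (fun z => positive_pairs (val z)).
- move=> v z; apply: (@continuous_comp _ _ _
    (fun x : set_type (sphere R k) => val x : 'rV[R]_k.+1)
    (fun x => positive_pairs x v)); first exact: (@set_val_continuous _ (sphere R k)).
  exact: positive_pairs_continuous.
- by move=> x; exact: positive_pairs_in.
exists f, g; split=> //.
- apply: (@homotopic_polyhedron R (set_type (@polyhedron R _ D)) _ D _ _
    (fun p v => (1 - p.2) * positive_pairs (val (f p.1)) v + p.2 * val p.1 v)).
  + move=> v; apply: continuousD_fun; apply: continuousM_fun.
    * by apply: continuousB_fun; [exact: cst_continuous|exact: continuous_snd].
    * move=> p; apply: (@continuous_comp _ _ _ fst
        (fun z => positive_pairs (val (f z)) v)); first exact: continuous_fst.
      apply: (@continuous_comp _ _ _ f (fun z => positive_pairs (val z) v)); first exact: cf.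
      apply: (@continuous_comp _ _ _ (fun x : set_type (sphere R k) => val x)
        (fun x => positive_pairs x v)); first exact: set_val_continuous.
      exact: positive_pairs_continuous.
    * exact: continuous_snd.
    * move=> p; apply: (@continuous_comp _ _ _ fst
        (fun y : set_type (@polyhedron R _ D) => val y v)); first exact: continuous_fst.
      apply: (@continuous_comp _ _ _
        (fun y : set_type (@polyhedron R _ D) => val y : {ptws pair2 k -> R})
        (fun y => y v)); first exact: set_val_continuous.
      exact: (@proj_continuous (pair2 k) (fun=> R) v).
  + move=> y t; rewrite in_itv /= => /andP[t0 t1].
    have yD := set_typeP y; have [y0 y1 _] := yD; split=> /=.
    * move=> v; apply: addr_ge0; apply: mulr_ge0;
        by [rewrite subr_ge0|exact: positive_pairs_ge0|exact: t0|exact: y0].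
    * have [t00|tn0] := eqVneq t 0.
        have [v vx] := positive_pairs_exists (x_neq0 (f y)); exists v.
        by rewrite t00 subr0 mul1r mul0r addr0.
      have [v _ yv] : exists2 v, xpredT v & 0 < val y v.
        by apply: sum_gt0P => //; rewrite y1 ltr01.
      exists v; apply: ltr_wpDl; last by rewrite mulr_gt0 // lt0r tn0.
      by apply: mulr_ge0; rewrite ?subr_ge0 // positive_pairs_ge0.
    * have [w [yw wy]] := moment_neg yD.
      apply: (@subcomplex_kneser _ w) => v; rewrite inE.
      have [->|yv _] := eqVneq (val y v) 0; last exact: yw.
      rewrite mulr0 addr0 mulf_eq0 negb_or => /andP[_ /negative_kneser]; apply=> c cw.
      by rewrite fE alternZ pmulr_rlt0 ?wy // invr_gt0 normE_gt0 // moment_neq0.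
  + by move=> y v; rewrite gE /=; congr (_ / _); [|apply: eq_bigr => ? _];
      rewrite subr0 mul1r mul0r addr0.
  + move=> y v /=; under eq_bigr do rewrite subrr mul0r add0r mul1r.
    by rewrite sumP subrr mul0r add0r mul1r divr1.
- apply: (@homotopic_sphere R k (set_type (sphere R k)) _ _
    (fun p => (1 - p.2) *: moment (val (g p.1)) + p.2 *: val p.1)).
  + move=> p; apply: cvgD; apply: cvgZ.
    * by apply: cvgB; [exact: cvg_cst|exact: continuous_snd].
    * apply: (@continuous_comp _ _ _ fst
        (fun z => moment (val (g z)))); first exact: continuous_fst.
      apply: (@continuous_comp _ _ _ g (fun z => moment (val z))); first exact: cg.
      apply: (@continuous_comp _ _ _
        (fun y : set_type (@polyhedron R _ D) => val y : {ptws pair2 k -> R})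
        moment); first exact: set_val_continuous.
      exact: moment_continuous.
    * exact: continuous_snd.
    * apply: (@continuous_comp _ _ _ fst
        (fun x : set_type (sphere R k) => val x)); first exact: continuous_fst.
      exact: set_val_continuous.
  + move=> x t; rewrite in_itv /= => /andP[t0 t1].
    (* At a point [c] where [x] is negative, no pair of positive weight contains [c], so the moment
       is negative there too. The whole segment is then negative at [c], hence avoids the origin. *)
    have [w wx] := altern_negative (x_neq0 x); have [c [d [_ wE]]] := pair2P w.
    have xc : altern (val x) c < 0 by apply: wx; rewrite wE !inE eqxx.
    have gc : altern (moment (val (g x))) c < 0.
      apply: altern_moment_lt0; first exact: set_typeP.
      move=> v; rewrite gE mulf_eq0 negb_or => /andP[/positive_pairs_neq0[_ vx] _].
      by apply: contraTN xc => /vx; rewrite -leNgt; exact: ltW.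
    apply: (@altern_lt0_neq0 _ c); rewrite alternD !alternZ.
    have [->|tn0] := eqVneq t 0; first by rewrite subr0 mul1r mul0r addr0.
    rewrite ltr_wnDl //; first by rewrite mulr_ge0_le0 ?subr_ge0 // ltW.
    by rewrite pmulr_rlt0 // lt0r tn0.
  + by move=> x /=; rewrite subr0 scale1r scale0r addr0 fE.
  + move=> x /=; rewrite subrr scale0r scale1r add0r.
    by rewrite normalize_sphere_id //; exact: set_typeP.
Qed.

End StableSphere.

(** * Induction on the number of unstable pairs *)

Lemma subcomplex_sphere (R : realType) (k : nat) (B : {set pair2 k}) :
  (forall v, v \in B -> ~~ stable v) ->
  homotopy_equivalent R (set_type (@polyhedron R _ (subcomplex B)))
    (set_type (sphere R k)).
Proof.
move: {2}#|B| (erefl #|B|) => m; elim: m B => [|m IHm] B mB nsB.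
  have /choice[u uP] (v : pair2 k) : exists x : 'rV[R]_k.+1,
      stable v -> forall c, c \notin val v -> altern x c < 0.
    have [/stable_altern-/(_ R)[x xP]|_] := boolP (stable v); first by exists x.
    (* An arbitrary value, since nothing is required at an unstable pair. *)
    by exists 0.
  by rewrite (cards0_eq mB); exact: subcomplex_stable_sphere uP.
have /card_gt0P[b bB] : (0 < #|B|)%N by rewrite mB.
apply: homotopy_equivalent_trans (remove_unstable R B (nsB _ bB)) _.
apply: IHm; first by move: mB; rewrite (cardsD1 b) bB => -[].
by move=> v; rewrite !inE => /andP[_ /nsB].
Qed.

Theorem corollary1p2 (R : realType) (k : nat) :
  homotopy_equivalent R
    (set_type (realization R (neighborhood_complex (S2 k))))
    (set_type (sphere R k)).
Proof.
(* With every unstable pair allowed, the condition on the vertices is vacuous and [subcomplex] is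
   the whole neighborhood complex. *)
have -> : realization R (neighborhood_complex (S2 k)) =
    polyhedron (subcomplex [set v : pair2 k | ~~ stable v]%SET).
  apply/seteqP; split=> y [y0 y1 yN]; split=> //; first last.
    by case/andP: yN.
  apply/andP; split=> //; apply/fintype.subsetP => v _; rewrite !inE; exact: orbN.
by apply: subcomplex_sphere => v; rewrite inE.
Qed.
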